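(* Let $\mathcal{U}$ be the collection of all compact ultrametric spaces (up to isometry), endowed with the Gromov-Hausdorff ultrametric $u_{\mathrm{GH}}$. Then $(\mathcal{U},u_{\mathrm{GH}})$ is a Urysohn universal ultrametric space, that is: (1) (universality) for every Polish ultrametric space $X$ there exists an isometric embedding $X\to(\mathcal{U},u_{\mathrm{GH}})$; (2) (ultra-homogeneity) for every finite ultrametric space $B$, every subset $A\subset B$ (with the restricted metric) and every isometric embedding $\varphi:A\to(\mathcal{U},u_{\mathrm{GH}})$, there exists an isometric embedding $\psi:B\to(\mathcal{U},u_{\mathrm{GH}})$ such that $\psi|_A=\varphi$.
   Context: An ultrametric space is a metric space $(X,u_X)$ satisfying the strong triangle inequality $u_X(x,z)\le\max(u_X(x,y),u_X(y,z))$ for all $x,y,z\in X$. A metric space is Polish if it is complete and separable. An isometric embedding is a distance-preserving map (not necessarily surjective). $\mathcal{U}$ denotes the collection of all (nonempty) compact ultrametric spaces, with isometric spaces identified. For $X,Y\in\mathcal{U}$, the Gromov-Hausdorff ultrametric is $$u_{\mathrm{GH}}(X,Y):=\inf_Z d_{\mathrm{H}}^Z(X,Y),$$ where the infimum is over all ultrametric spaces $Z$ and all isometric embeddings of $X$ into $Z$ and of $Y$ into $Z$, and $d_{\mathrm{H}}^Z$ is the Hausdorff distance in $Z$ between the images. It is known that $(\mathcal{U},u_{\mathrm{GH}})$ is an ultrametric space. *)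

(* Defs.v *)
From mathcomp Require Import all_boot all_order all_algebra.
From mathcomp Require Import all_classical all_reals all_analysis.

Set Implicit Arguments.
Unset Strict Implicit.
Unset Printing Implicit Defensive.

Import Order.TTheory GRing.Theory Num.Theory.

Local Open Scope classical_set_scope.
Local Open Scope ring_scope.

(* The collection U of compact ultrametric spaces lives one universe above the
   spaces themselves, so it cannot carry a [metricType] instance. The notions
   that have to apply both to a [metricType] and to U are therefore stated for
   a bare distance function. *)

Definition strong_triangle (R : realType) (T : Type) (d : T -> T -> R) : Prop :=
  forall x y z, d x z <= Num.max (d x y) (d y z).

Definition is_ultrametric (R : realType) (T : Type) (d : T -> T -> R) : Prop :=
  [/\ forall x y, 0 <= d x y,
      forall x y, d x y = 0 <-> x = y,
      forall x y, d x y = d y x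
    & strong_triangle d].

Definition isometric_embedding (R : realType) (S T : Type)
    (dS : S -> S -> R) (dT : T -> T -> R) (f : S -> T) : Prop :=
  forall x y, dT (f x) (f y) = dS x y.

Definition ultrametric (R : realType) (X : metricType R) : Prop :=
  strong_triangle (@mdist R X).

(* Same condition as in the library's [completeType], which however excludes
   the empty space because it requires a distinguished point. *)
Definition complete_space (R : realType) (X : metricType R) : Prop :=
  forall F : set_system X, ProperFilter F -> cauchy F ->
    exists x : X, F --> x.

Definition separable_space (R : realType) (X : metricType R) : Prop :=
  exists2 D : set X, countable D & dense D.

Definition polish (R : realType) (X : metricType R) : Prop :=
  complete_space X /\ separable_space X.

Definition hausdorff_dist (R : realType) (Z : metricType R) (A B : set Z) : R :=
  Num.max (sup [set inf [set mdist a b | b in B] | a in A])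
          (sup [set inf [set mdist a b | a in A] | b in B]).

Record compact_ultrametric (R : realType) := CompactUltrametric {
  cu_space :> metricType R;
  cu_ultrametric : ultrametric cu_space;
  cu_nonempty : [set: cu_space] !=set0;
  cu_compact : compact [set: cu_space] }.

Definition isometric (R : realType) (X Y : compact_ultrametric R) : Prop :=
  exists2 f : X -> Y, isometric_embedding mdist mdist f & bijective f.

Definition uGH_space (R : realType) (X Y : compact_ultrametric R) : R :=
  inf [set r | exists Z : metricType R, ultrametric Z /\
        exists (f : X -> Z) (g : Y -> Z),
          [/\ isometric_embedding mdist mdist f,
              isometric_embedding mdist mdist g
            & r = hausdorff_dist (range f) (range g)]].

(* An element of [ultra_classes R] is an isometry class of compact ultrametric
   spaces, so that [=] on this type identifies isometric spaces. *)
Definition ultra_classes (R : realType) : Type :=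
  {C : compact_ultrametric R -> Prop | exists X, C = isometric X}.

Definition class_of (R : realType) (X : compact_ultrametric R) :
    ultra_classes R :=
  exist _ (isometric X) (ex_intro _ X erefl).

Definition class_repr (R : realType) (x : ultra_classes R) :
    compact_ultrametric R :=
  projT1 (cid (proj2_sig x)).

(* By [uGH_class_of] the value does not depend on the representatives. *)
Definition uGH (R : realType) (x y : ultra_classes R) : R :=
  uGH_space (class_repr x) (class_repr y).

Lemma isometric_refl (R : realType) (X : compact_ultrametric R) :
  isometric X X.
Proof. by exists id => //; exists id. Qed.

Lemma isometric_sym (R : realType) (X Y : compact_ultrametric R) :
  isometric X Y -> isometric Y X.
Proof.
move=> [f fi [g fK gK]]; exists g; last by exists f.
by move=> x y; rewrite -fi !gK.
Qed.

Lemma isometric_trans (R : realType) (X Y Z : compact_ultrametric R) :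
  isometric X Y -> isometric Y Z -> isometric X Z.
Proof.
move=> [f fi fb] [g gi gb]; exists (g \o f); last exact: bij_comp.
by move=> x y; rewrite /= gi fi.
Qed.

Lemma class_ofP (R : realType) (X Y : compact_ultrametric R) :
  class_of X = class_of Y <-> isometric X Y.
Proof.
split=> [/(congr1 (@proj1_sig _ _))/= ->|XY]; first exact: isometric_refl.
apply: eq_sig_hprop => [? ? ?|/=]; first exact: Prop_irrelevance.
apply/funext => Z; apply/propext; split.
  exact/isometric_trans/isometric_sym.
exact: isometric_trans.
Qed.

Lemma class_reprK (R : realType) : cancel (@class_repr R) (@class_of R).
Proof.
move=> x; apply: eq_sig_hprop => [? ? ?|/=]; first exact: Prop_irrelevance.
by rewrite /class_repr; case: (cid _) => X /= ->.
Qed.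

Lemma uGH_class_of (R : realType) (X Y : compact_ultrametric R) :
  uGH (class_of X) (class_of Y) = uGH_space X Y.
Proof.
have XX' : isometric (class_repr (class_of X)) X
  by apply/class_ofP; rewrite class_reprK.
have YY' : isometric (class_repr (class_of Y)) Y
  by apply/class_ofP; rewrite class_reprK.
rewrite /uGH /uGH_space; congr inf.
move: XX' YY' => [h hi [h' hK hK']] [k ki [k' kK kK']].
apply/seteqP; split=> r [Z [uZ [f [g [fi gi ->]]]]]; exists Z; split=> //.
- exists (f \o h'), (g \o k'); split.
  + by move=> x y /=; rewrite fi -hi !hK'.
  + by move=> x y /=; rewrite gi -ki !kK'.
  + congr hausdorff_dist; apply/seteqP; split=> _ [x _ <-].
    * by exists (h x) => //=; rewrite hK.
    * by exists (h' x).
    * by exists (k x) => //=; rewrite kK.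
    * by exists (k' x).
- exists (f \o h), (g \o k); split.
  + by move=> x y /=; rewrite fi hi.
  + by move=> x y /=; rewrite gi ki.
  + congr hausdorff_dist; apply/seteqP; split=> _ [x _ <-].
    * by exists (h' x) => //=; rewrite hK'.
    * by exists (h x).
    * by exists (k' x) => //=; rewrite kK'.
    * by exists (k x).
Qed.

Definition universal (R : realType) (U : Type) (dU : U -> U -> R) : Prop :=
  forall X : metricType R, ultrametric X -> polish X ->
    exists f : X -> U, isometric_embedding mdist dU f.

Definition ultrahomogeneous (R : realType) (U : Type) (dU : U -> U -> R) :
    Prop :=
  forall B : metricType R, ultrametric B -> finite_set [set: B] ->
  forall (A : set B) (phi : A -> U),
    isometric_embedding (fun a a' : A => mdist (val a) (val a')) dU phi ->
    exists2 psi : B -> U,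
      isometric_embedding mdist dU psi & forall a : A, psi (val a) = phi a.

(* Main.v *)
(* Two compact ultrametric spaces are at distance at most t > 0 iff some map
   between them preserves all distances above t and is t-dense, i.e. iff their
   quotients by closed t-balls are isometric. Such maps compose and have
   quasi-inverses at the same scale, whence the strong triangle inequality, and
   a compactness argument gives separation.

   Universality: a point x of a separable ultrametric space with dense sequence
   (u n) is determined at scale t by the first index n with u n in the closed
   t-ball of x. Encoding these indices as cardinalities of t-quotients of an
   explicit countable space depending on x gives an isometric embedding.

   Ultrahomogeneity: around every point of U and for every r > 0 there are
   infinitely many points at mutual distance r, namely finite spaces of
   different cardinalities whose points are at least r apart. This yields
   one-point extensions: place the new point at distance r = d(b, c) from the
   image of a nearest old point c, away from the other images. *)
Require Import Defs.
From HB Require Import structures.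
From mathcomp Require Import all_boot all_order all_algebra.
From mathcomp Require Import all_classical all_reals all_analysis.

Set Implicit Arguments.
Unset Strict Implicit.
Unset Printing Implicit Defensive.

Import Order.Theory GRing.Theory Num.Theory.

Local Open Scope classical_set_scope.
Local Open Scope ring_scope.

(** * Comparing reals through thresholds; metric spaces from bare ultrametrics *)

Lemma le_max_of_bounds (R : realType) (a b c : R) :
  (forall s, a <= s -> b <= s -> c <= s) -> c <= Num.max a b.
Proof. by apply; rewrite le_max lexx ?orbT. Qed.

(** Only positive thresholds are tested, because maps between compact spaces are compared at
    positive scales only. *)
Lemma eq_of_le_pos (R : realType) (a b : R) : 0 <= a -> 0 <= b ->
  (forall s, 0 < s -> (a <= s) = (b <= s)) -> a = b.
Proof.
move=> a0 b0 ab; apply/eqP; rewrite eq_le; apply/andP; split.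
- by apply/ler_addgt0Pr => e e0; rewrite ab ?lerDl ?ltW// ltr_wpDl.
- by apply/ler_addgt0Pr => e e0; rewrite -ab ?lerDl ?ltW// ltr_wpDl.
Qed.

Lemma ultrametric_le (R : realType) (X : metricType R) (x y z : X) (s : R) :
  ultrametric X -> mdist x y <= s -> mdist y z <= s -> mdist x z <= s.
Proof. by move=> uX xy yz; rewrite (le_trans (uX x y z))// ge_max xy. Qed.

(** The proof is kept as an index of the type, so that one carrier can receive several metric
    instances, one per distance. *)
Definition space_of (R : realType) (T : Type) (d : T -> T -> R)
  (_ : is_ultrametric d) : Type := T.

Section space_of.
Context (R : realType) (T : Type) (d : T -> T -> R) (dP : is_ultrametric d).

Let d_refl x : d x x = 0.
Proof. by have [_ /(_ x x)[_ ->]] := dP. Qed.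

Let d_pos x y : d x y = 0 -> x = y.
Proof. by have [_ /(_ x y)[]] := dP. Qed.

Let d_sym x y : d x y = d y x.
Proof. by have [] := dP. Qed.

Let d_triangle y x z : d x z <= d x y + d y z.
Proof.
have [d0 _ _ /(_ x y z)] := dP; move=> /le_trans; apply.
by rewrite ge_max lerDl lerDr !d0.
Qed.

HB.instance Definition _ := gen_eqMixin (space_of dP).
HB.instance Definition _ := gen_choiceMixin (space_of dP).
HB.instance Definition _ := isMetric.Build R (space_of dP)
  d_refl d_pos d_sym d_triangle.

Lemma space_ofE (x y : space_of dP) : mdist x y = d x y.
Proof. by []. Qed.

Lemma space_of_ultrametric : ultrametric (space_of dP).
Proof. by case: dP. Qed.

End space_of.

(** * Isometries at scale [t] *)

(* For closed balls of radius [t], this says that [f] induces an isometry of the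
   quotients of [X] and [Y] that collapse each such ball to a point. *)
Definition approx_isometry (R : realType) (X Y : metricType R) (t : R)
    (f : X -> Y) : Prop :=
  (forall s x x', t <= s -> (mdist (f x) (f x') <= s) = (mdist x x' <= s)) /\
  forall y, exists x, mdist (f x) y <= t.

Lemma approx_isometry_comp (R : realType) (X Y Z : metricType R) (t : R)
    (f : X -> Y) (g : Y -> Z) : ultrametric Z ->
  approx_isometry t f -> approx_isometry t g -> approx_isometry t (g \o f).
Proof.
move=> uZ [fi fs] [gi gs]; split=> [s x x' ts|z] /=; first by rewrite gi// fi.
have [y yz] := gs z; have [x xy] := fs y; exists x.
by apply: (ultrametric_le uZ _ yz); rewrite gi.
Qed.

Lemma approx_isometry_inv (R : realType) (X Y : metricType R) (t : R)
    (f : X -> Y) : ultrametric Y -> approx_isometry t f ->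
  exists2 g : Y -> X, approx_isometry t g & forall y, mdist (f (g y)) y <= t.
Proof.
move=> uY [fi /choice[g fg]]; exists g => //; split=> [s y y' ts|x].
- have fgs z : mdist (f (g z)) z <= s by rewrite (le_trans (fg z)).
  rewrite -fi//; apply/idP/idP => h.
  + apply: (ultrametric_le uY _ (fgs y')); apply: (ultrametric_le uY _ h).
    by rewrite metric_sym.
  + apply: (ultrametric_le uY (fgs y)); apply: (ultrametric_le uY h).
    by rewrite metric_sym.
- by exists (f x); rewrite -fi.
Qed.

(** Pigeonhole: sending [i] to a [j] whose ball contains [f (p i)] is injective, since two points of
    one closed [t]-ball are at most [t] apart and [f] reflects this. *)
Lemma approx_isometry_card (R : realType) (X Y : metricType R) (t : R)
    (f : X -> Y) (I J : finType) (p : I -> X) (c : J -> Y) :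
  ultrametric Y -> approx_isometry t f ->
  (forall i j, i != j -> t < mdist (p i) (p j)) ->
  (forall y, exists j, mdist y (c j) <= t) ->
  (#|I| <= #|J|)%N.
Proof.
move=> uY [fi _] psep ccov.
have [k fk] := choice (fun i => ccov (f (p i))).
apply: (@leq_card _ _ k) => i j kij; apply/eqP; apply: contraT => /psep.
rewrite ltNge -fi// (ultrametric_le uY (fk i))//.
by rewrite kij metric_sym.
Qed.

(** * Finite nets, bounded diameter and ultrafilter limits in compact spaces *)

Lemma compact_net (R : realType) (X : metricType R) (t : R) :
  compact [set: X] -> 0 < t ->
  exists s : seq X, forall x, exists2 y, y \in s & mdist y x <= t.
Proof.
move=> cX t0; apply: contrapT => nonet.
(* Without a finite net these sets generate a proper filter; a cluster point [p] of it would have to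
   be adherent to [out [:: p]]. *)
pose out (s : seq X) : set X := [set x | forall y, y \in s -> t < mdist y x].
have F0 : ProperFilter (filter_from setT out).
  apply: filter_from_proper; last first.
    move=> s _; apply: contrapT => s0; apply: nonet; exists s => x.
    apply: contrapT => sx; apply: s0; exists x => y ys; rewrite ltNge.
    by apply/negP => yx; apply: sx; exists y.
  apply: filter_from_filter; first by exists [::].
  move=> s s' _ _; exists (s ++ s') => // x sx.
  by split=> y ys; apply: sx; rewrite mem_cat ys ?orbT.
have [p [_]] := cX _ F0 (@filterT _ _ F0).
move=> /(_ (out [:: p]) (ball p t)) [||x []]; first by exists [:: p].
- exact: nbhsx_ballx.
- rewrite ballEmdist /= => /(_ p (mem_head _ _)) tpx.
  by rewrite ltNge (ltW tpx).
Qed.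

Lemma compact_bounded (R : realType) (X : metricType R) :
  compact [set: X] -> ultrametric X ->
  exists2 b : R, 0 < b & forall x y : X, mdist x y <= b.
Proof.
move=> cX uX; have [s sX] := compact_net cX (@ltr01 R).
pose B := \big[Num.max/1]_(y <- s) \big[Num.max/1]_(z <- s) mdist y z.
have B1 : 1 <= B by exact: bigmax_ge_id.
exists B => [|x x']; first exact: lt_le_trans ltr01 B1.
have [y ys yx] := sX x; have [z zs zx] := sX x'.
apply: (ultrametric_le uX (y := y)).
  by rewrite metric_sym (le_trans yx).
apply: (ultrametric_le uX (y := z)); last exact: le_trans zx B1.
apply: (bigmax_sup_seq _ y) => //.
exact: (bigmax_sup_seq _ z).
Qed.

Lemma ultra_limit (R : realType) (T : Type) (X : metricType R)
    (G : set_system T) (u : T -> X) : UltraFilter G -> compact [set: X] ->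
  exists l, forall e, 0 < e -> \forall t \near G, mdist (u t) l <= e.
Proof.
move=> GU cX; have [l [_ lu]] := cX (u @ G) _ (@filterT _ _ _).
exists l => e e0.
have [//|Gn] := in_ultra_setVsetC [set t | mdist (u t) l <= e] GU.
have lu_far : (u @ G) [set x | e < mdist x l].
  apply: (@filterS _ G _ _ _ _ Gn) => t /= tn.
  by rewrite ltNge; exact/negP.
have [x []] := lu _ _ lu_far (nbhsx_ballx _ _ e0).
by rewrite ballEmdist /= metric_sym => ex /(lt_trans ex); rewrite ltxx.
Qed.

(** * The Gromov-Hausdorff distance in terms of approximate isometries *)

Section gromov_hausdorff.
Context (R : realType).
Implicit Types X Y Z : compact_ultrametric R.

Definition approx_isometric (t : R) X Y : Prop :=
  exists f : X -> Y, approx_isometry t f.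

Lemma approx_isometric_trans t X Y Z :
  approx_isometric t X Y -> approx_isometric t Y Z -> approx_isometric t X Z.
Proof.
move=> [f fP] [g gP]; exists (g \o f).
exact: approx_isometry_comp (@cu_ultrametric _ Z) fP gP.
Qed.

Lemma approx_isometric_sym t X Y :
  approx_isometric t X Y -> approx_isometric t Y X.
Proof.
by move=> [f /(approx_isometry_inv (@cu_ultrametric _ Y))[g gP _]]; exists g.
Qed.

Lemma approx_isometric_exists X Y : exists2 t, 0 < t & approx_isometric t X Y.
Proof.
have [b b0 bX] := compact_bounded (@cu_compact _ X) (@cu_ultrametric _ X).
have [c c0 cY] := compact_bounded (@cu_compact _ Y) (@cu_ultrametric _ Y).
have [x0 _] := @cu_nonempty _ X; have [y0 _] := @cu_nonempty _ Y.
(* Above both diameters every comparison is true, so a constant map qualifies. *)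
exists (Num.max b c); first by rewrite lt_max b0.
exists (fun=> y0); split=> [s x x'|y]; last first.
  by exists x0; rewrite (le_trans (cY _ _))// le_max lexx orbT.
rewrite ge_max => /andP[bs cs].
by rewrite (le_trans (cY _ _) cs) (le_trans (bX _ _) bs).
Qed.

Section glue.
Variables (X Y : compact_ultrametric R) (t : R) (f : X -> Y).
Hypotheses (t0 : 0 < t) (fP : approx_isometry t f).

(** The maximum with [t] keeps the two copies disjoint, and puts [x] and [f x] exactly [t] apart. *)
Definition glue_dist (z z' : X + Y) : R :=
  match z, z' with
  | inl x, inl x' => mdist x x'
  | inr y, inr y' => mdist y y'
  | inl x, inr y | inr y, inl x => Num.max t (mdist (f x) y)
  end.

Lemma glue_ultrametric : is_ultrametric glue_dist.
Proof.
have [fi _] := fP.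
have uX := @cu_ultrametric _ X; have uY := @cu_ultrametric _ Y.
have m0 y y' : Num.max t (mdist y y') = 0 :> R -> False.
  by move=> /eqP; rewrite gt_eqF// lt_max t0.
split.
- by move=> [x|y] [x'|y'] /=; rewrite ?mdist_ge0// le_max (ltW t0).
- move=> [x|y] [x'|y'] /=; split; try by move=> /m0.
  + by move=> /mdist_positivity ->.
  + by move=> [->]; rewrite mdistxx.
  + by [].
  + by [].
  + by move=> /mdist_positivity ->.
  + by move=> [->]; rewrite mdistxx.
- by move=> [x|y] [x'|y'] //=; rewrite metric_sym.
- move=> [x|y] [x'|y'] [x''|y''] /=; apply: le_max_of_bounds => s;
    rewrite ?ge_max.
  + exact: ultrametric_le.
  + move=> xx' /andP[ts ?]; rewrite ts (ultrametric_le uY (y := f x'))//.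
    by rewrite fi.
  + move=> /andP[ts ?] /andP[_ ?]; rewrite -(fi s)//.
    by apply: (ultrametric_le uY (y := y')) => //; rewrite metric_sym.
  + by move=> /andP[-> ?] ?; rewrite (ultrametric_le uY (y := y')).
  + move=> /andP[ts ?] xx'; rewrite ts (ultrametric_le uY (y := f x'))//.
    by rewrite fi// metric_sym.
  + move=> /andP[ts ?] /andP[_ ?].
    by rewrite (ultrametric_le uY (y := f x'))// metric_sym.
  + move=> ? /andP[-> ?]; rewrite (ultrametric_le uY (y := y'))//.
    by rewrite metric_sym.
  + exact: ultrametric_le.
Qed.

End glue.

Lemma hausdorff_dist_le (Z : metricType R) (A B : set Z) t :
  A !=set0 -> B !=set0 ->
  (forall a, A a -> exists2 b, B b & mdist a b <= t) ->
  (forall b, B b -> exists2 a, A a & mdist a b <= t) ->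
  hausdorff_dist A B <= t.
Proof.
move=> [a0 Aa0] [b0 Bb0] AB BA; rewrite ge_max; apply/andP; split.
- apply: ge_sup; first by exists (inf [set mdist a0 b | b in B]), a0.
  move=> _ [a Aa <-]; have [b Bb] := AB a Aa; apply: le_trans.
  apply: ge_inf; last by exists b.
  by exists 0 => _ [b' _ <-]; exact: mdist_ge0.
- apply: ge_sup; first by exists (inf [set mdist a b0 | a in A]), b0.
  move=> _ [b Bb <-]; have [a Aa] := BA b Bb; apply: le_trans.
  apply: ge_inf; last by exists a.
  by exists 0 => _ [a' _ <-]; exact: mdist_ge0.
Qed.

Lemma hausdorff_dist_ge0 (Z : metricType R) (A B : set Z) :
  0 <= hausdorff_dist A B.
Proof.
rewrite le_max; apply/orP; left; set S := (X in sup X).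
have S0 r : S r -> 0 <= r.
  move=> [a Aa <-]; have [[b Bb]|B0] := pselect (B !=set0).
    apply: lb_le_inf; first by exists (mdist a b), b.
    by move=> _ [b' _ <-]; exact: mdist_ge0.
  rewrite inf_out// => -[[_ [b Bb _]] _]; apply: B0; by exists b.
have [[[r Sr] ubS]|/sup_out-> //] := pselect (has_sup S).
exact: le_trans (S0 _ Sr) (ub_le_sup ubS Sr).
Qed.

(** The bound [M] makes the suprema genuine: [sup] of an unbounded set is 0 by default. *)
Lemma hausdorff_dist_lt (Z : metricType R) (A B : set Z) t :
  A !=set0 -> B !=set0 ->
  (exists M, forall a b, A a -> B b -> mdist a b <= M) ->
  hausdorff_dist A B < t ->
  (forall a, A a -> exists2 b, B b & mdist a b <= t) /\
  (forall b, B b -> exists2 a, A a & mdist a b <= t).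
Proof.
move=> [a0 Aa0] [b0 Bb0] [M ABM]; rewrite gt_max => /andP[ltA ltB]; split.
- move=> a Aa; have : inf [set mdist a b | b in B] < t.
    apply: le_lt_trans ltA; apply: ub_le_sup; last by exists a.
    exists M => _ [a' Aa' <-]; apply: le_trans (ABM a' b0 Aa' Bb0).
    apply: ge_inf; last by exists b0.
    by exists 0 => _ [b' _ <-]; exact: mdist_ge0.
  move=> /inf_lt[|_ [b Bb <-] /ltW]; first by exists (mdist a b0), b0.
  by exists b.
- move=> b Bb; have : inf [set mdist a b | a in A] < t.
    apply: le_lt_trans ltB; apply: ub_le_sup; last by exists b.
    exists M => _ [b' Bb' <-]; apply: le_trans (ABM a0 b' Aa0 Bb').
    apply: ge_inf; last by exists a0.
    by exists 0 => _ [a' _ <-]; exact: mdist_ge0.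
  move=> /inf_lt[|_ [a Aa <-] /ltW]; first by exists (mdist a0 b), a0.
  by exists a.
Qed.

Let uGH_set X Y := [set r | exists Z : metricType R, ultrametric Z /\
        exists (f : X -> Z) (g : Y -> Z),
          [/\ isometric_embedding mdist mdist f,
              isometric_embedding mdist mdist g
            & r = hausdorff_dist (range f) (range g)]].

Let uGH_set_ge0 X Y r : uGH_set X Y r -> 0 <= r.
Proof. by move=> [Z [_ [f [g [_ _ ->]]]]]; exact: hausdorff_dist_ge0. Qed.

Let approx_isometric_uGH_set t X Y : 0 < t -> approx_isometric t X Y ->
  exists2 r, uGH_set X Y r & r <= t.
Proof.
move=> t0 [f fP].
pose Z : metricType R := space_of (glue_ultrametric t0 fP).
pose i : X -> Z := inl; pose j : Y -> Z := inr.
exists (hausdorff_dist (range i) (range j)).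
  exists Z; split; first exact: space_of_ultrametric.
  by exists i, j.
have [x0 _] := @cu_nonempty _ X; have [y0 _] := @cu_nonempty _ Y.
apply: hausdorff_dist_le.
- by exists (i x0), x0.
- by exists (j y0), y0.
- move=> _ [x _ <-]; exists (j (f x)); first by exists (f x).
  by rewrite space_ofE /= mdistxx ge_max lexx ltW.
- move=> _ [y _ <-]; have [x fxy] := fP.2 y; exists (i x); first by exists x.
  by rewrite space_ofE /= ge_max lexx.
Qed.

Lemma uGH_space_ge0 X Y : 0 <= uGH_space X Y.
Proof.
have [t t0 /(approx_isometric_uGH_set t0)[r rS _]] :=
  approx_isometric_exists X Y.
by apply: lb_le_inf; [exists r | exact: uGH_set_ge0].
Qed.

Lemma uGH_space_le t X Y : 0 < t -> approx_isometric t X Y ->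
  uGH_space X Y <= t.
Proof.
move=> t0 /(approx_isometric_uGH_set t0)[r rS]; apply: le_trans.
by apply: ge_inf => //; exists 0; exact: uGH_set_ge0.
Qed.

(** Let [f] pick a point of [Y] within [t] in the common space [Z]. By the strong triangle
    inequality, moving endpoints by at most [t] does not affect comparisons with any [s >= t]. *)
Lemma uGH_space_lt t X Y : uGH_space X Y < t -> approx_isometric t X Y.
Proof.
have [T T0 /(approx_isometric_uGH_set T0)[r0 r0S _]] :=
  approx_isometric_exists X Y.
have [x0 _] := @cu_nonempty _ X; have [y0 _] := @cu_nonempty _ Y.
move=> /inf_lt[|_ [Z [uZ [i [j [ii ji ->]]]]]]; first by exists r0.
have [b b0 bX] := compact_bounded (@cu_compact _ X) (@cu_ultrametric _ X).
have [c c0 cY] := compact_bounded (@cu_compact _ Y) (@cu_ultrametric _ Y).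
move=> /hausdorff_dist_lt[|||XY YX].
- by exists (i x0), x0.
- by exists (j y0), y0.
- exists (b + (mdist (i x0) (j y0) + c)) => _ _ [x _ <-] [y _ <-].
  rewrite (le_trans (metric_triangle _ (i x0) _))// lerD ?ii//.
  by rewrite (le_trans (metric_triangle _ (j y0) _))// lerD ?ji.
have /choice[f fP] : forall x, exists y, mdist (i x) (j y) <= t.
  by move=> x; have [|_ [y _ <-] xy] := XY (i x); [exists x | exists y].
exists f; split=> [s x x' ts|y].
  rewrite -ji -ii; have fs z : mdist (i z) (j (f z)) <= s.
    exact: le_trans (fP z) ts.
  apply/idP/idP => h.
  - apply: (ultrametric_le uZ (fs x)); apply: (ultrametric_le uZ h).
    by rewrite metric_sym.
  - apply: (ultrametric_le uZ _ (fs x')); apply: (ultrametric_le uZ _ h).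
    by rewrite metric_sym.
have [|_ [x _ <-] xy] := YX (j y); first by exists y.
by exists x; rewrite -ji (ultrametric_le uZ _ xy)// metric_sym.
Qed.

(* The [t]-isometries [f t] and their quasi-inverses [g t] converge pointwise
   along an ultrafilter refining [t --> 0^+]; the limits are inverse
   isometries. *)
Lemma approx_isometric_isometric X Y :
  (forall t, 0 < t -> approx_isometric t X Y) -> isometric X Y.
Proof.
move=> XY; have uY := @cu_ultrametric _ Y; have uX := @cu_ultrametric _ X.
have /choice[f fP] : forall t : R, exists f : X -> Y,
    0 < t -> approx_isometry t f.
  move=> t; have [/XY[f fP]|_] := ltP 0 t; first by exists f.
  by have [y0 _] := @cu_nonempty _ Y; exists (fun=> y0).
have /choice[g gP] : forall t : R, exists g : Y -> X, 0 < t ->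
    approx_isometry t g /\ forall y, mdist (f t (g y)) y <= t.
  move=> t; have [t0|_] := ltP 0 t.
    by have [g gP fg] := approx_isometry_inv uY (fP t t0); exists g.
  by have [x0 _] := @cu_nonempty _ X; exists (fun=> x0).
have [G [GU GP]] := ultraFilterLemma (@at_right_proper_filter R 0).
have /choice[F FP] :=
  fun x => ultra_limit (fun t => f t x) GU (@cu_compact _ Y).
have /choice[H HP] :=
  fun y => ultra_limit (fun t => g t y) GU (@cu_compact _ X).
have Gpos (s : R) : 0 < s -> \forall t \near G, 0 < t <= s.
  move=> s0; apply: GP; near=> t; apply/andP; split; near: t.
    exact: nbhs_right_gt.
  exact: nbhs_right_le.
have Fi : isometric_embedding mdist mdist F.
  move=> x x'; apply: eq_of_le_pos; rewrite ?mdist_ge0// => s s0.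
  have [t [/andP[t0 ts] [fx fx']]] := @filter_ex _ G _ _
    (filterI (Gpos s s0) (filterI (FP x s s0) (FP x' s s0))).
  have [fi _] := fP t t0; rewrite -(fi s)//; apply/idP/idP => h.
  - apply: (ultrametric_le uY fx); apply: (ultrametric_le uY h).
    by rewrite metric_sym.
  - apply: (ultrametric_le uY _ fx'); apply: (ultrametric_le uY _ h).
    by rewrite metric_sym.
have FH y : F (H y) = y.
  apply: mdist_positivity; apply: eq_of_le_pos; rewrite ?mdist_ge0// => s s0.
  rewrite (ltW s0).
  have [t [/andP[t0 ts] [fh h]]] := @filter_ex _ G _ _
    (filterI (Gpos s s0) (filterI (FP (H y) s s0) (HP y s s0))).
  have [fi _] := fP t t0; have [_ /(_ y) fg] := gP t t0.
  apply: (ultrametric_le uY (y := f t (H y))); first by rewrite metric_sym.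
  apply: (ultrametric_le uY (y := f t (g t y))); last exact: le_trans fg ts.
  by rewrite fi// metric_sym.
exists F => //; exists H => // x; apply: mdist_positivity.
by rewrite -Fi FH mdistxx.
Unshelve. all: by end_near. Qed.

End gromov_hausdorff.

(** Symmetry and the triangle inequality are checked at thresholds slightly above the distances,
    where approximate isometries are available. *)
Lemma is_ultrametric_uGH (R : realType) : is_ultrametric (@uGH R).
Proof.
split.
- by move=> x y; exact: uGH_space_ge0.
- move=> x y; rewrite -(class_reprK x) -(class_reprK y) uGH_class_of class_ofP.
  split=> [xy0|[f fi [g fK gK]]].
    apply: approx_isometric_isometric => t t0.
    by apply: uGH_space_lt; rewrite xy0.
  apply: eq_of_le_pos; rewrite ?uGH_space_ge0// => s s0; rewrite (ltW s0).
  apply: uGH_space_le => //; exists f; split=> [r a b _|b]; first by rewrite fi.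
  by exists (g b); rewrite gK mdistxx ltW.
- have le x y : uGH x y <= uGH y x :> R.
    apply/ler_addgt0Pr => e e0; apply: uGH_space_le.
      by rewrite ltr_wpDl// uGH_space_ge0.
    by apply/approx_isometric_sym/uGH_space_lt; rewrite ltrDl.
  by move=> x y; apply/eqP; rewrite eq_le !le.
- move=> x y z; apply/ler_addgt0Pr => e e0.
  have m0 : 0 <= Num.max (uGH x y) (uGH y z).
    by rewrite le_max uGH_space_ge0.
  apply: uGH_space_le; first by rewrite ltr_wpDl.
  apply: (approx_isometric_trans (Y := class_repr y)); apply: uGH_space_lt.
    by apply: (@le_lt_trans _ _ (Num.max (uGH x y) (uGH y z)));
      rewrite ?ltrDl// le_max lexx.
  by apply: (@le_lt_trans _ _ (Num.max (uGH x y) (uGH y z)));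
    rewrite ?ltrDl// le_max lexx orbT.
Qed.

(** * Combs: countable compact spaces encoding sequences of indices *)

Lemma offdiag_ultrametric (R : realType) (T : eqType) (e : T -> T -> R) :
  (forall x y, x != y -> 0 < e x y) -> (forall x y, e x y = e y x) ->
  strong_triangle e ->
  is_ultrametric (fun x y => if x == y then 0 else e x y).
Proof.
move=> e0 eC et.
have d0 x y : 0 <= (if x == y then 0 else e x y).
  by case: ifPn => // /e0/ltW.
split=> //.
- move=> x y; split=> [|->]; last by rewrite eqxx.
  by case: ifPn => [/eqP//|/e0 + exy]; rewrite exy ltxx.
- by move=> x y; rewrite eq_sym eC.
- move=> x y z; have [->|xz] := eqVneq x z; first by rewrite le_max d0.
  have [<-|xy] := eqVneq x y; first by rewrite (negPf xz) le_max lexx orbT.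
  by have [<-|yz] := eqVneq y z; [rewrite le_max lexx | exact: et].
Qed.

Section comb.
Context (R : realType).
Implicit Types (w : nat -> R) (t : R).

(** Running minima are nonincreasing, so the teeth of weight above [t] form an initial segment,
    ending just before the first [n] with [w n <= t]. *)
Fixpoint runmin w n : R :=
  if n is m.+1 then Num.min (runmin w m) (w m.+1) else w 0.

Lemma runmin_gt w t n :
  reflect (forall j, (j <= n)%N -> t < w j) (t < runmin w n).
Proof.
elim: n => [|n IHn] /=.
  by apply: (iffP idP) => [tw j|->//]; rewrite leqn0 => /eqP ->.
rewrite lt_min; apply: (iffP andP) => [[/IHn tw tn] j|tw].
  by rewrite leq_eqVlt => /predU1P[->//|]; exact: tw.
by split; [apply/IHn => j jn; exact/tw/leqW | exact: tw].
Qed.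

Lemma runmin_le w w' s n : (forall j, (w j <= s) = (w' j <= s)) ->
  (runmin w n <= s) = (runmin w' n <= s).
Proof. by move=> ww'; elim: n => [|n IHn] //=; rewrite !ge_min IHn ww'. Qed.

(* The space [option nat], where [None] is the limit point and [Some n] has
   distance [runmin w n] to it. *)
Definition comb_weight w (a : option nat) : R :=
  if a is Some n then runmin w n else 0.

Definition comb_dist w (a b : option nat) : R :=
  if a == b then 0 else Num.max (comb_weight w a) (comb_weight w b).

Section comb_space.
Variable w : nat -> R.
Hypothesis w_gt0 : forall n, 0 < w n.
Hypothesis w_small : forall t, 0 < t -> exists n, w n <= t.

Lemma comb_ultrametric : is_ultrametric (comb_dist w).
Proof.
apply: offdiag_ultrametric.
- have rw n : 0 < runmin w n by apply/runmin_gt => j _; exact: w_gt0.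
  by move=> [m|] [n|]//= _; rewrite lt_max rw ?orbT.
- by move=> x y; rewrite maxC.
- move=> x y z; apply: le_max_of_bounds => s.
  by rewrite !ge_max => /andP[-> _] /andP[_ ->].
Qed.

(** If [None] is not a cluster point, a member of the filter misses a ball around it. Only finitely
    many points lie outside that ball, so the filter contains a finite set. *)
Lemma comb_compact : compact [set: space_of comb_ultrametric].
Proof.
move=> F FF _; have [//|F0] := pselect (cluster F None); first by exists None.
suff [n Fn] : exists n, F (Some @` `I_n : set (space_of comb_ultrametric)).
  have fin : finite_set (Some @` `I_n : set (space_of comb_ultrametric)).
    exact/finite_image/finite_II.
  by have [p [_ ?]] := finite_compact fin FF Fn; exists p.
move: F0; rewrite /cluster /= => /existsNP[A] /existsNP[B].
move=> /not_implyP[FA] /not_implyP[/nbhs_ballP[t /= t0 tB] AB].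
(* Halving [t] turns the weak bound on [w n] into the strict one required by the open ball. *)
have [n wn] := w_small (divr_gt0 t0 (@ltr0n R 2)).
exists n; apply: filterS FA => a Aa.
have /negP : ~ mdist (None : space_of comb_ultrametric) a < t.
  move=> ta; apply: AB; exists a; split=> //.
  by apply: tB; rewrite ballEmdist.
rewrite -leNgt space_ofE /comb_dist; case: a Aa => [m|] Am /=; last first.
  by rewrite leNgt t0.
rewrite le_max leNgt t0 /= => tm; exists m => //=; rewrite ltnNge.
apply/negP => nm; suff : runmin w m < t by rewrite ltNge tm.
rewrite ltNge; apply/negP => /= tm'.
have : t / 2 < runmin w m.
  by rewrite (lt_le_trans _ tm')// ltr_pdivrMr// ltr_pMr// ltr1n.
by move=> /runmin_gt/(_ n nm); rewrite ltNge wn.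
Qed.

Definition comb : compact_ultrametric R :=
  @CompactUltrametric R (space_of comb_ultrametric)
    (@space_of_ultrametric _ _ _ comb_ultrametric)
    (ex_intro _ None I) comb_compact.

End comb_space.

(* Level [t > 0] of a comb has exactly [n.+1] classes, where [n] is the first
   index with [w n <= t]. *)
Lemma comb_first_le w w' (w0 : forall n, 0 < w n) (w'0 : forall n, 0 < w' n)
    (ws : forall t, 0 < t -> exists n, w n <= t)
    (w's : forall t, 0 < t -> exists n, w' n <= t) t n n' :
  0 < t -> approx_isometric t (comb w0 ws) (comb w'0 w's) ->
  (forall j, (j < n)%N -> t < w j) -> w' n' <= t -> (n <= n')%N.
Proof.
move=> t0 [f fP] wn wn'; rewrite -ltnS.
(* The extra [None] is the limit point, representing the class of all teeth of weight at most [t];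
   it accounts for the successor on both sides. *)
pose p (i : option 'I_n) : comb w0 ws := omap val i.
pose c (i : option 'I_n') : comb w'0 w's := omap val i.
rewrite -[n]card_ord -[n']card_ord -!card_option.
apply: (approx_isometry_card (p := p) (c := c) _ fP).
- exact: cu_ultrametric.
- have wt (i : 'I_n) : t < runmin w i.
    by apply/runmin_gt => j ji; apply: wn; exact: leq_ltn_trans ji (ltn_ord i).
  move=> i j ij; rewrite space_ofE /comb_dist ifF; last first.
    apply/negbTE/eqP => pij; move/eqP: ij; apply.
    by move: i j pij => [i|] [j|]//= [/val_inj ->].
  by move: i j ij => [i|] [j|]//= _; rewrite lt_max ?wt ?orbT.
- move=> [m|]; last by exists None; rewrite mdistxx ltW.
  have [mn'|n'm] := ltnP m n'.
    by exists (Some (Ordinal mn')); rewrite mdistxx ltW.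
  exists None; rewrite space_ofE /comb_dist /= ge_max (ltW t0) andbT leNgt.
  by apply/negP => /runmin_gt/(_ _ n'm); rewrite ltNge wn'.
Qed.

End comb.

(** * Universality *)

Lemma invS_small (R : realType) (t : R) : 0 < t ->
  exists n, n.+1%:R^-1 <= t.
Proof.
move=> t0; exists (Num.truncn t^-1); rewrite invf_ple ?posrE//.
by rewrite ltW// truncnS_gt.
Qed.

Lemma separable_seq (R : realType) (X : metricType R) (x0 : X) :
  separable_space X ->
  exists (u : nat -> X) (e : nat -> R), (forall n, 0 < e n) /\
    forall x t, 0 < t -> exists n, Num.max (mdist x (u n)) (e n) <= t.
Proof.
move=> [D /countable_injP[f fI] dD].
have /choice[v vP] : forall i, exists y, forall z, D z -> f z = i -> y = z.
  move=> i; have [[y [Dy fy]]|ni] := pselect (exists y, D y /\ f y = i).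
    by exists y => z Dz fz; apply: fI; rewrite ?inE// fz.
  by exists x0 => z Dz fz; exfalso; apply: ni; exists z.
(* Each [n] codes a pair: a dense point and the precision [m] giving [e n = 1/(m+1)]. Every dense
   point thus recurs with arbitrarily small [e]. Non-codes default to [(0, 0)]. *)
pose im n := odflt (0, 0)%N (unpickle n : option (nat * nat)).
exists (fun n => v (im n).1), (fun n => (im n).2.+1%:R^-1).
split=> [n|x t t0]; first by rewrite invr_gt0 ltr0n.
have [|y [/interior_subset xy Dy]] := dD (ball x t)^° _ (open_interior _).
  by exists x; exact: nbhsx_ballx.
have [m mt] := invS_small t0.
exists (pickle (f y, m)); rewrite /im pickleK /= ge_max mt andbT.
by rewrite (vP (f y) y)//; move: xy; rewrite ballEmdist => /ltW.
Qed.

(* With [(u n)] dense and [e n] small, [x] is sent to the comb with parameters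
   [max (d x (u n)) (e n)]. Level [t] of the comb records the first [n] with
   [d x (u n) <= t] and [e n <= t]; for two points at distance [d], all levels
   [t >= d] agree and no level [t < d] does. *)
Lemma universal_uGH (R : realType) : universal (@uGH R).
Proof.
move=> X uX [_ sX]; have [[x0 _]|X0] := pselect ([set: X] !=set0); last first.
  have X0' (x : X) : False by apply: X0; exists x.
  by exists (fun x => match X0' x with end) => x; case: (X0' x).
have [u [e [e0 ue]]] := separable_seq x0 sX.
pose w x n := Num.max (mdist x (u n)) (e n).
have w0 x n : 0 < w x n by rewrite lt_max e0 orbT.
exists (fun x => class_of (comb (w0 x) (ue x))) => x y; rewrite uGH_class_of.
have [->|xy] := eqVneq x y.
  rewrite mdistxx -uGH_class_of; set c := class_of _.
  by have [_ /(_ c c)[_ ->]] := is_ultrametric_uGH R.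
apply/eqP; rewrite eq_le; apply/andP; split.
  apply: uGH_space_le; first by rewrite mdist_gt0.
  exists id; split=> [s a b ds|a]; last first.
    by exists a; rewrite mdistxx mdist_ge0.
  have s0 : 0 <= s by rewrite (le_trans _ ds)// mdist_ge0.
  have ww n : (w y n <= s) = (w x n <= s).
    rewrite !ge_max; congr (_ && _); apply/idP/idP => h.
      exact: (ultrametric_le uX ds h).
    by apply: (ultrametric_le uX _ h); rewrite metric_sym.
  have wt c : (comb_weight (w y) c <= s) = (comb_weight (w x) c <= s).
    by case: c => [n|] //=; exact: runmin_le.
  by rewrite !space_ofE /comb_dist; case: ifP => // _; rewrite !ge_max !wt.
rewrite leNgt; apply/negP => lt_xy.
have g0 := uGH_space_ge0 (comb (w0 x) (ue x)) (comb (w0 y) (ue y)).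
set g := uGH_space _ _ in lt_xy g0 *; pose t := (g + mdist x y) / 2.
have gt : g < t by rewrite midf_lt.
have td : t < mdist x y by rewrite midf_lt.
have t0 : 0 < t := le_lt_trans g0 gt.
have /= E := uGH_space_lt gt.
have first z : exists2 n, w z n <= t & forall j, (j < n)%N -> t < w z j.
  have ex := ue z t t0; case: (ex_minnP ex) => n wn n_min.
  exists n => // j jn; rewrite ltNge; apply/negP => /n_min.
  by rewrite leqNgt jn.
have [m xm mx] := first x; have [n yn ny] := first y.
(* Both first indices are read off from combs that agree at level [t]; a common index puts [x] and
   [y] within [t] of the same [u n]. *)
have mn : m = n.
  apply/eqP; rewrite eqn_leq (comb_first_le t0 E mx yn).
  by rewrite (comb_first_le t0 (approx_isometric_sym E) ny xm).
move: xm yn; rewrite mn !ge_max => /andP[xu _] /andP[yu _].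
suff : mdist x y <= t by rewrite leNgt td.
by apply: (ultrametric_le uX xu); rewrite metric_sym.
Qed.

(** * Infinitely many equidistant points around each point of the space *)

Section homogeneity.
Context (R : realType).

Section finite_space.
Variables (Y : compact_ultrametric R) (r : R) (N : nat) (g : 'I_N.+1 -> Y).
Hypothesis r0 : 0 < r.

(* If the [g i] form an [r]-net, this space is at distance at most [r] from [Y],
   and it is its own [t]-quotient for [t < r], so [N] can be recovered there. *)
Definition thick_dist (i j : 'I_N.+1) : R :=
  if i == j then 0 else Num.max r (mdist (g i) (g j)).

Lemma thick_ultrametric : is_ultrametric thick_dist.
Proof.
apply: offdiag_ultrametric => [i j _|i j|i j k].
- by rewrite lt_max r0.
- by rewrite metric_sym.
- apply: le_max_of_bounds => s; rewrite !ge_max => /andP[-> ij] /andP[_ jk].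
  exact: (ultrametric_le (@cu_ultrametric _ Y) ij jk).
Qed.

Lemma thick_compact : compact [set: space_of thick_ultrametric].
Proof. exact/finite_compact/(@finite_finset 'I_N.+1). Qed.

Definition thick : compact_ultrametric R :=
  @CompactUltrametric R (space_of thick_ultrametric)
    (@space_of_ultrametric _ _ _ thick_ultrametric)
    (ex_intro _ ord0 I) thick_compact.

Lemma thick_approx : (forall y, exists i, mdist (g i) y <= r) ->
  approx_isometric r thick Y.
Proof.
move=> gr; exists g; split=> // s i j rs; rewrite space_ofE /thick_dist.
have s0 : 0 <= s by rewrite ltW// (lt_le_trans r0).
by case: eqVneq => [->|_]; rewrite ?mdistxx// ge_max rs.
Qed.

End finite_space.

Lemma thick_card (Y Y' : compact_ultrametric R) (r : R) (N N' : nat)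
    (g : 'I_N.+1 -> Y) (g' : 'I_N'.+1 -> Y') (r0 : 0 < r) t :
  0 <= t -> t < r -> approx_isometric t (thick g r0) (thick g' r0) ->
  (N <= N')%N.
Proof.
move=> t0 tr [f fP]; rewrite -ltnS -[N.+1]card_ord -[N'.+1]card_ord.
apply: (approx_isometry_card (p := id : _ -> thick g r0)
  (c := id : _ -> thick g' r0) _ fP).
- exact: cu_ultrametric.
- by move=> i j ij; rewrite space_ofE /thick_dist (negPf ij) lt_max tr.
- by move=> j; exists j; rewrite mdistxx.
Qed.

Lemma uGH_sphere (x : ultra_classes R) (r : R) : 0 < r ->
  exists v : nat -> ultra_classes R, (forall n, uGH (v n) x <= r) /\
    forall m n, m != n -> r <= uGH (v m) (v n).
Proof.
move=> r0; pose Y := class_repr x; rewrite -(class_reprK x) -/Y.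
have [y0 _] := @cu_nonempty _ Y.
have [s sY] := compact_net (@cu_compact _ Y) r0.
(* Indices beyond the net repeat [y0]; [thick] separates these repetitions by [r], so the
   cardinality grows with [n] while the net property persists. *)
pose g n (i : 'I_(size s + n).+1) : Y := nth y0 s i.
exists (fun n => class_of (thick (g n) r0)); split=> [n|].
  rewrite uGH_class_of; apply: uGH_space_le => //; apply: thick_approx => y.
  have [z zs zy] := sY y.
  have iz : (index z s < (size s + n).+1)%N.
    by rewrite ltnS (leq_trans (index_size _ _))// leq_addr.
  by exists (Ordinal iz); rewrite /g /= nth_index.
move=> m n mn; rewrite uGH_class_of leNgt; apply: contra mn => lt_r.
have := uGH_space_ge0 (thick (g m) r0) (thick (g n) r0).
set d := uGH_space _ _ in lt_r * => d0; pose t := (d + r) / 2.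
have dt : d < t by rewrite midf_lt.
have tr : t < r by rewrite midf_lt.
have t0 : 0 <= t := le_trans d0 (ltW dt).
have E := uGH_space_lt dt.
rewrite eqn_leq -(leq_add2l (size s)) (thick_card t0 tr E) /=.
by rewrite -(leq_add2l (size s)) (thick_card t0 tr (approx_isometric_sym E)).
Qed.

End homogeneity.

(** * Extension of finite partial isometries *)

Section extension.
Context (R : realType) (U : Type) (dU : U -> U -> R).
Hypothesis dUP : is_ultrametric dU.

Let dU_le x y z s : dU x y <= s -> dU y z <= s -> dU x z <= s.
Proof.
move=> xy yz; have [_ _ _ /(_ x y z)/le_trans] := dUP; apply.
by rewrite ge_max xy.
Qed.

Let dUC x y : dU x y = dU y x.
Proof. by have [] := dUP. Qed.

Hypothesis sphere : forall (x : U) (r : R), 0 < r ->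
  exists v : nat -> U, (forall n, dU (v n) x <= r) /\
    forall m n, m != n -> r <= dU (v m) (v n).

(* Infinitely many points lie at mutual distance [r] in the ball of radius [r]
   around [x], and a point of [s] can be at distance [< r] from only one of
   them, so one is left that avoids all of [s]. *)
Lemma sphere_avoiding (x : U) (r : R) (T : eqType) (s : seq T) (f : T -> U) :
  0 < r -> exists y, dU y x <= r /\ forall a, a \in s -> r <= dU y (f a).
Proof.
move=> r0; have [v [vx vv]] := sphere x r0.
apply: contrapT => none.
have /choice[k kP] : forall n, exists a, a \in s /\ dU (v n) (f a) < r.
  move=> n; apply: contrapT => na; apply: none; exists (v n); split=> // a as_.
  by rewrite leNgt; apply/negP => lt_r; apply: na; exists a.
suff : (size (map k (iota 0 (size s).+1)) <= size s)%N.
  by rewrite size_map size_iota ltnn.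
apply: uniq_leq_size; last by move=> _ /mapP[n _ ->]; have [] := kP n.
rewrite map_inj_uniq ?iota_uniq// => m n kmn; apply/eqP.
apply: contraT => /vv; rewrite leNgt => /negP[].
have [_ m1] := kP m; have [_ n1] := kP n.
have [_ _ _ /(_ (v m) (f (k m)) (v n))/le_lt_trans] := dUP; apply.
by rewrite gt_max m1 kmn dUC n1.
Qed.

Lemma seq_minimizer (T : eqType) (h : T -> R) (s : seq T) : s != [::] ->
  exists2 c, c \in s & forall a, a \in s -> h c <= h a.
Proof.
elim: s => // x s IHs _; have [->|/IHs[c cs cmin]] :=
  eqVneq s [::].
  by exists x; rewrite ?mem_head// => a; rewrite inE => /eqP ->.
have [xc|cx] := leP (h x) (h c).
- exists x; first exact: mem_head.
  by move=> a; rewrite inE => /predU1P[->//|/cmin]; exact: le_trans.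
- exists c; first by rewrite inE cs orbT.
  by move=> a; rewrite inE => /predU1P[->|/cmin//]; exact: ltW.
Qed.

Lemma one_point_extension (B : metricType R) (b : B) (s : seq B) (f : B -> U) :
  ultrametric B -> b \notin s ->
  {in s &, forall x y, dU (f x) (f y) = mdist x y} ->
  exists u, forall a, a \in s -> dU u (f a) = mdist b a.
Proof.
move=> uB bs fi; have [->|/(seq_minimizer (mdist b))[c cs cmin]] :=
  eqVneq s [::].
  by exists (f b).
have r0 : 0 < mdist b c.
  by rewrite mdist_gt0; apply: contraNneq bs => ->.
have [u [uc us]] := sphere_avoiding (f c) s f r0.
exists u => a as_; have bca := cmin a as_; apply: eq_of_le_pos => [||t _].
- by have [] := dUP.
- exact: mdist_ge0.
(* Below [mdist b c] both comparisons fail, [c] being nearest and [u] avoiding all images. From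
   there on, [b] may be replaced by [c] and [u] by [f c]. *)
have [ct|tc] := leP (mdist b c) t; last first.
  rewrite (lt_geF (lt_le_trans tc bca)).
  by rewrite (lt_geF (lt_le_trans tc (us a as_))).
apply/idP/idP => h.
- apply: (ultrametric_le uB ct); rewrite -fi//.
  by apply: (dU_le _ h); rewrite dUC (le_trans uc).
- apply: (dU_le (le_trans uc ct)); rewrite fi//.
  by apply: (ultrametric_le uB _ h); rewrite metric_sym.
Qed.

(** Induction on a list of points adjoined to [A], finally applied to an enumeration of [B]. The
    point of [U] serves as default value outside [A]. *)
Lemma sphere_ultrahomogeneous : U -> ultrahomogeneous dU.
Proof.
move=> u0 B uB /finite_seqP[e eB] A phi phiP.
have eT (b : B) : b \in e by have : [set: B] b by []; rewrite eB.
pose extends (s : seq B) := exists psi : B -> U,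
  (forall a : A, psi (val a) = phi a) /\
  {in [pred b | (b \in A) || (b \in s)] &,
    forall x y, dU (psi x) (psi y) = mdist x y}.
suff ext s : extends s.
  have [psi [psiA psiP]] := ext e; exists psi => // x y.
  by rewrite psiP// inE eT orbT.
elim: s => [|x s [psi [psiA psiP]]].
  have /choice[psi psiA] : forall b, exists u, forall a : A,
      val a = b -> u = phi a.
    move=> b; have [[a ab]|na] := pselect (exists a : A, val a = b).
      by exists (phi a) => a' a'b; congr phi; apply: val_inj; rewrite ab a'b.
    by exists u0 => a ab; exfalso; apply: na; exists a.
  exists psi; split=> [a|x y]; first exact: psiA.
  rewrite !inE !orbF => xA yA.
  by rewrite (psiA x (exist _ x xA))// (psiA y (exist _ y yA))// phiP.
have [xAs|xAs] := boolP ((x \in A) || (x \in s)).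
  exists psi; split=> // y z yAs zAs; apply: psiP.
  - by move: yAs; rewrite !inE orbCA => /predU1P[->|].
  - by move: zAs; rewrite !inE orbCA => /predU1P[->|].
(* The current domain, a predicate, is listed by filtering the enumeration [e] of [B]. *)
have [||u uP] := @one_point_extension B x
    [seq y <- e | (y \in A) || (y \in s)] psi uB.
- by rewrite mem_filter (negPf xAs).
- by move=> y z; rewrite !mem_filter => /andP[yAs _] /andP[zAs _]; exact: psiP.
exists (fun y => if y == x then u else psi y); split=> [a|y z].
  rewrite ifN ?psiA//; apply: contraNneq xAs => <-.
  by rewrite (valP a).
have uP' c : (c \in A) || (c \in s) -> dU u (psi c) = mdist x c.
  by move=> cAs; apply: uP; rewrite mem_filter cAs eT.
rewrite !inE !(orbCA (_ \in A)).
have [->|_] := eqVneq y x; have [->|_] := eqVneq z x => //= yAs zAs.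
- by rewrite mdistxx; have [_ /(_ u u)[_ ->]] := dUP.
- exact: uP'.
- by rewrite dUC metric_sym uP'.
- exact: psiP.
Qed.

End extension.

Theorem theorem3p2 (R : realType) :
  [/\ is_ultrametric (@uGH R), universal (@uGH R)
    & ultrahomogeneous (@uGH R)].
Proof.
split; [exact: is_ultrametric_uGH | exact: universal_uGH |].
apply: sphere_ultrahomogeneous.
- exact: is_ultrametric_uGH.
- exact: uGH_sphere.
- have w0 n : 0 < n.+1%:R^-1 :> R by rewrite invr_gt0 ltr0n.
  exact: class_of (comb w0 (@invS_small R)).
Qed.
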